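(* Let $K$ be a field, $d\in\mathbb{N}$ and $R=K[x_1,\ldots,x_d]$. Let $I$ be a monomial ideal of $R$ with $\partial\mathrm{oc}(I)\neq\emptyset$. Then there is a unique pair of monomial ideals $J,H$ of $R$ such that $I=J\cap H$, $H$ is zero-dimensional, $\partial\mathrm{oc}(H)=\partial\mathrm{oc}(I)$, and $\partial\mathrm{oc}(J)=\emptyset$.
   Context: For a monomial ideal $I$ of $R$ and $\mathfrak{m}=(x_1,\ldots,x_d)$, the docle $\partial\mathrm{oc}(I)$ is the set of monomials in $(I:\mathfrak{m})\setminus I$; i.e. the monomials $a\notin I$ with $x_ia\in I$ for all $i$. An ideal $H$ is zero-dimensional if $R/H$ is finite-dimensional over $K$. The unit ideal $R$ counts as a monomial ideal. *)

(* Defs.v *)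
From mathcomp Require Import all_boot all_order all_algebra.
From mathcomp Require Import boolp classical_sets.
From mathcomp Require Import mpoly.

Set Implicit Arguments.
Unset Strict Implicit.
Unset Printing Implicit Defensive.

Local Open Scope classical_set_scope.
Local Open Scope ring_scope.

(* The unit ideal is allowed, which rules out the [idealr] structures of
   ring_quotient: they only cover proper ideals. *)
Definition is_ideal (R : comNzRingType) (I : set R) : Prop :=
  [/\ I 0, (forall f g, I f -> I g -> I (f + g))
    & forall a f, I f -> I (a * f)].

Definition ideal_gen (R : comNzRingType) (S : set R) : set R :=
  smallest (@is_ideal R) S.

Definition colon (R : comNzRingType) (I L : set R) : set R :=
  [set f | forall g, L g -> I (f * g)].

Section MonomialIdeals.
Variables (K : fieldType) (d : nat).
Implicit Types I H : set {mpoly K[d]}.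

Definition monomials : set {mpoly K[d]} := range (fun a : 'X_{1..d} => 'X_[a]).

Definition monomial_ideal I : Prop :=
  exists2 S : set {mpoly K[d]}, S `<=` monomials & I = ideal_gen S.

Definition irrelevant_ideal : set {mpoly K[d]} :=
  ideal_gen (range (fun i : 'I_d => 'X_i)).

Definition docle I : set {mpoly K[d]} :=
  monomials `&` (colon I irrelevant_ideal `\` I).

(* The classes of b_0, ..., b_(n-1) span R/H over K. *)
Definition zero_dimensional H : Prop :=
  exists (n : nat) (b : 'I_n -> {mpoly K[d]}),
    forall f, exists c : 'I_n -> K, H (f - \sum_(i < n) c i *: b i).

End MonomialIdeals.

(* Main.v *)
(* A monomial ideal is determined by the exponents outside it, which form a
   down-closed set; the docle consists of the maximal ones. Zero-dimensionality
   says that the exponents outside H have bounded degree, so each lies below a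
   maximal one and H is determined by its docle; conversely the docle of I is an
   antichain, finite by Dickson's lemma, so its down-closure is the complement of
   a zero-dimensional H. If J has empty docle, one can climb from any exponent
   outside J past every degree, hence into H; so the exponents outside J are
   exactly those lying below an exponent of H outside I. *)

Require Import Defs.
From mathcomp Require Import all_boot all_order all_algebra.
From mathcomp Require Import boolp classical_sets.
From mathcomp Require Import mpoly.

Set Implicit Arguments.
Unset Strict Implicit.
Unset Printing Implicit Defensive.

Import GRing.Theory.

Local Open Scope classical_set_scope.
Local Open Scope ring_scope.

(** * Sequences of exponents and Dickson's lemma *)

Lemma nondecreasing_subseq (f : nat -> nat) :
  exists phi : nat -> nat, {homo phi : i j / (i < j)%N} /\
    {homo f \o phi : i j / (i <= j)%N}.
Proof.
have tail_min n : exists m, (n <= m)%N /\ forall k, (n <= k)%N -> (f m <= f k)%N.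
  pose P v := `[< exists2 m, (n <= m)%N & f m = v >].
  have exP : exists v, P v by exists (f n); apply/asboolP; exists n.
  case: (ex_minnP exP) => v /asboolP[m le_nm <-] min_v.
  by exists m; split=> // k le_nk; apply: min_v; apply/asboolP; exists k.
have [g gP] := choice tail_min.
(* Each index is a place where the tail starting just after the previous index attains its minimum,
   so later values cannot be smaller. *)
pose phi := fix phi k := if k is k'.+1 then g (phi k').+1 else g 0%N.
have phiS k : (phi k < phi k.+1)%N by rewrite /=; case: (gP (phi k).+1).
have fphiS k : (f (phi k) <= f (phi k.+1))%N.
  case: k => [|k]; first by case: (gP 0%N) => _; apply.
  by case: (gP (phi k).+1) => _; apply; apply: ltn_trans (phiS k) (phiS k.+1).
exists phi; split; first exact: homo_ltn ltn_trans phiS.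
exact: (homo_leq (f := f \o phi) leqnn leq_trans fphiS).
Qed.

(** Extracting a nondecreasing subsequence for one coordinate after another makes every coordinate
    nondecreasing; any two terms then compare. *)
Lemma dickson d (s : nat -> 'X_{1..d}) :
  exists i j, (i < j)%N /\ (s i <= s j)%MM.
Proof.
have [phi [phi_lt phi_le]] : exists phi : nat -> nat,
    {homo phi : i j / (i < j)%N} /\
    forall l, l \in enum 'I_d -> {homo (fun k => s (phi k) l) : i j / (i <= j)%N}.
  elim: (enum 'I_d) => [|l r [phi [phi_lt phi_le]]]; first by exists id; split=> // l.
  have [psi [psi_lt psi_le]] := nondecreasing_subseq (fun k => s (phi k) l).
  have psi_leq : {homo psi : i j / (i <= j)%N} by exact: ltnW_homo.
  exists (phi \o psi); split=> [i j lt_ij|l']; first exact/phi_lt/psi_lt.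
  rewrite inE => /predU1P[->|/phi_le le_l'] i j le_ij; first exact: psi_le.
  by apply: le_l'; apply: psi_leq.
exists (phi 0%N), (phi 1%N); split; first exact: phi_lt.
by apply/mnm_lepP => l; apply: (phi_le l) => //; rewrite mem_enum.
Qed.

Lemma unbounded_mdeg_seq d (D : set 'X_{1..d}) :
    (forall N, exists2 a, D a & (N <= mdeg a)%N) ->
  exists s : nat -> 'X_{1..d}, (forall k, D (s k)) /\
    {homo (fun k => mdeg (s k)) : i j / (i < j)%N}.
Proof.
move=> unbounded.
have /choice[g gP] N : exists a, D a /\ (N <= mdeg a)%N.
  by have [a Da le_Na] := unbounded N; exists a.
pose s := fix s k := if k is k'.+1 then g (mdeg (s k')).+1 else g 0%N.
exists s; split=> [[|k]|]; rewrite /=; [by case: (gP 0%N)|by case: (gP (mdeg (s k)).+1)|].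
by apply: (homo_ltn ltn_trans) => k /=; case: (gP (mdeg (s k)).+1).
Qed.

Lemma unbounded_mdegN d (D : set 'X_{1..d}) :
    (~ exists N, forall a, D a -> (mdeg a < N)%N) ->
  forall N, exists2 a, D a & (N <= mdeg a)%N.
Proof.
move=> unbounded N; apply: contrapT => noa; apply: unbounded.
by exists N => a Da; rewrite ltnNge; apply/negP => le_Na; apply: noa; exists a.
Qed.

Lemma lem_lt_addU d (a b : 'X_{1..d}) : (a <= b)%MM -> a <> b ->
  exists i, (a + U_(i) <= b)%MM.
Proof.
move=> /mnm_lepP le_ab ne_ab.
have [i lt_i] : exists i, (a i < b i)%N.
  apply: contrapT => noi; apply: ne_ab; apply/mnmP => i; apply/eqP.
  by rewrite eqn_leq le_ab leqNgt; apply/negP => lt_i; apply: noi; exists i.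
exists i; apply/mnm_lepP => j; rewrite mnmDE mnm1E.
by case: eqP => [<-|_]; rewrite ?addn1 // addn0.
Qed.

(** Otherwise some sequence in [D] has strictly increasing degrees, and Dickson's lemma yields two
    comparable, hence equal, terms of it. *)
Lemma antichain_mdeg_bounded d (D : set 'X_{1..d}) :
    (forall a b, D a -> D b -> (a <= b)%MM -> a = b) ->
  exists N, forall a, D a -> (mdeg a < N)%N.
Proof.
move=> antiD; apply: contrapT => /unbounded_mdegN/unbounded_mdeg_seq [s [Ds s_lt]].
have [i [j [/s_lt lt_ij le_ij]]] := dickson s.
by move: lt_ij; rewrite (antiD _ _ (Ds i) (Ds j) le_ij) ltnn.
Qed.

Lemma mdeg_le d (a b : 'X_{1..d}) : (a <= b)%MM -> (mdeg a <= mdeg b)%N.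
Proof. by move=> le_ab; rewrite -(submK le_ab) mdegD leq_addl. Qed.

(** Meant for [D] the exponents outside an ideal, when none of them above [b] is maximal. *)
Lemma climb_mdeg d (D : set 'X_{1..d}) b : D b ->
    (forall c, D c -> (b <= c)%MM -> exists i, D (c + U_(i))%MM) ->
  forall N, exists c, [/\ D c, (b <= c)%MM & (N <= mdeg c)%N].
Proof.
move=> Db step; elim=> [|N [c [Dc le_bc le_N]]].
  by exists b; split=> //; apply: lepm_refl.
have [i Dci] := step c Dc le_bc; exists (c + U_(i))%MM.
split=> //; first exact: lepm_trans le_bc (lem_addr _ _).
by rewrite mdegD mdeg1 addn1.
Qed.

(** * Monomial ideals and up-closed sets of exponents *)

Section MonomialIdealSupport.
Variables (K : fieldType) (d : nat).
Implicit Types (I H : set {mpoly K[d]}) (U : set 'X_{1..d}).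

Definition supported_in U : set {mpoly K[d]} :=
  [set f | forall m, m \in msupp f -> U m].

Definition up_closed U := forall a b, U a -> (a <= b)%MM -> U b.

Lemma ideal_gen_ideal (S : set {mpoly K[d]}) : is_ideal (ideal_gen S).
Proof.
split=> [T [[T0 _ _] _]|f g If Ig T TP|a f If T TP] //.
- by have [_ TD _] := TP.1; apply: TD; [apply: If|apply: Ig].
- by have [_ _ TM] := TP.1; apply: TM; apply: If.
Qed.

Lemma monomial_ideal_ideal {I} : monomial_ideal I -> is_ideal I.
Proof. by case=> S _ ->; apply: ideal_gen_ideal. Qed.

Lemma ideal_sum {I} (iI : is_ideal I) (T : eqType) (r : seq T) (F : T -> {mpoly K[d]}) :
  (forall x, x \in r -> I (F x)) -> I (\sum_(x <- r) F x).
Proof.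
by case: iI => I0 ID _ IF; rewrite big_seq; apply: big_ind => //.
Qed.

Lemma ideal_support {I f} : is_ideal I ->
  (forall m, m \in msupp f -> I 'X_[m]) -> I f.
Proof.
move=> iI If; rewrite [f]mpolyE; apply: ideal_sum => // m /If.
by rewrite -mul_mpolyC; case: iI => _ _; apply.
Qed.

Lemma supported_in_ideal U : up_closed U -> is_ideal (supported_in U).
Proof.
move=> upU; split=> [m|f g Uf Ug m|a f Uf m]; first by rewrite msupp0.
  by move=> /msuppD_le; rewrite mem_cat => /orP[/Uf|/Ug].
move=> /msuppM_le /allpairsP[[m1 m2] /= [_ /Uf Um2 ->]].
by apply: upU Um2 _; apply: lem_addl.
Qed.

Lemma supported_inX U m : supported_in U 'X_[m] <-> U m.
Proof.
by split=> [|Um m']; [apply; rewrite msuppX inE|rewrite msuppX inE => /eqP->].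
Qed.

Lemma ideal_up {I} : is_ideal I -> up_closed [set a | I 'X_[a]].
Proof.
by move=> [_ _ IM] a b /= Ia le_ab; rewrite -(submK le_ab) mpolyXD; apply: IM.
Qed.

(** The right-hand side is an ideal containing the generators, so it contains [I]; conversely a
    polynomial is the sum of its terms. *)
Lemma monomial_idealE {I} : monomial_ideal I -> I = supported_in [set a | I 'X_[a]].
Proof.
move=> monI; have iI := monomial_ideal_ideal monI.
apply/seteqP; split=> f; last exact: ideal_support iI.
case: monI iI => S monS -> iI; apply.
split=> [|g Sg]; first exact/supported_in_ideal/ideal_up.
have [m _ def_g] := monS g Sg; rewrite -def_g; apply/supported_inX => /=.
by move=> T [_]; apply; rewrite def_g.
Qed.

Lemma monomial_ideal_eq {I H} : monomial_ideal I -> monomial_ideal H ->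
  (forall a, I 'X_[a] <-> H 'X_[a]) -> I = H.
Proof.
move=> monI monH eqIH; rewrite (monomial_idealE monI) (monomial_idealE monH).
by apply/seteqP; split=> f If m /If /eqIH.
Qed.

Lemma supported_in_monomial U : up_closed U -> monomial_ideal (supported_in U).
Proof.
move=> upU; exists (@monomials K d `&` supported_in U); first by move=> f [].
apply/seteqP; split=> f; last first.
  by apply; split; [exact: supported_in_ideal|move=> g []].
move=> Uf; apply: ideal_support; first exact: ideal_gen_ideal.
by move=> m /Uf Um T [_]; apply; split; [exists m|apply/supported_inX].
Qed.

(** * The docle in terms of exponents *)

Lemma docleX I a : is_ideal I ->
  docle I 'X_[a] <-> ~ I 'X_[a] /\ forall i, I 'X_[a + U_(i)].
Proof.
move=> [I0 ID IM]; split=> [[_ [Ia nIa]]|[nIa Ia]].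
  by split=> // i; rewrite mpolyXD; apply: Ia => T [_]; apply; exists i.
split; first by exists a.
(* The [h] with ['X_[a] * h] in [I] form an ideal; it contains the variables, hence the irrelevant
   ideal. *)
split=> // g /(_ [set h | I ('X_[a] * h)]); apply; split=> [|_ [i _ <-] /=]; last by rewrite -mpolyXD.
by split=> [|f h|h f] /=; rewrite ?mulr0 ?mulrDr; [|exact: ID|rewrite mulrCA; exact: IM].
Qed.

Lemma docle_eq I H : (forall a, docle I 'X_[a] <-> docle H 'X_[a]) -> docle I = docle H.
Proof.
by move=> eqIH; apply/seteqP; split=> f fD; have [[a _ def_f] _] := fD;
  move: fD; rewrite -def_f => /eqIH.
Qed.

Lemma docle_antichain I a b : is_ideal I ->
  docle I 'X_[a] -> docle I 'X_[b] -> (a <= b)%MM -> a = b.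
Proof.
move=> iI /docleX - /(_ iI)[_ aP] /docleX - /(_ iI)[nIb _] le_ab.
apply: contrapT => /(lem_lt_addU le_ab)[i le_aib].
exact/nIb/(ideal_up iI (aP i)).
Qed.

(** * Zero-dimensional monomial ideals *)

Lemma bounded_zero_dimensional H : monomial_ideal H ->
  (exists N, forall a, ~ H 'X_[a] -> (mdeg a < N)%N) -> zero_dimensional H.
Proof.
move=> monH [N boundN].
(* Once the terms of degree below [N] are removed from [f], only terms in [H] remain. *)
exists #|{: 'X_{1..d < N}}|, (fun i => 'X_[bmnm (enum_val i)]) => f.
exists (fun i => f@_(bmnm (enum_val i))); rewrite (monomial_idealE monH) => m.
rewrite -(big_enum_val (fun m : 'X_{1..d < N} => f@_m *: 'X_[m])) /=.
apply: contraPP => /boundN lt_mN; rewrite mcoeff_msupp mcoeffB raddf_sum /=.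
rewrite (bigD1 (BMultinom lt_mN)) //= big1 => [|m' ne_m'].
  by rewrite mcoeffZ mcoeffX eqxx mulr1 addr0 subrr eqxx.
by rewrite mcoeffZ mcoeffX (negPf (_ : bmnm m' != m)) ?mulr0 // -val_eqE.
Qed.

(* Over R/H, n + 1 monomials written in terms of n spanning classes satisfy a
   nontrivial linear relation, hence one of them lies in H. *)
Lemma zero_dimensional_bounded H : monomial_ideal H -> zero_dimensional H ->
  exists N, forall a, ~ H 'X_[a] -> (mdeg a < N)%N.
Proof.
move=> monH [n [b spanb]]; have iH := monomial_ideal_ideal monH.
apply: contrapT => /unbounded_mdegN/unbounded_mdeg_seq [s [nHs s_lt]].
have inj_s : injective s.
  by move=> i j eq_s; have [/s_lt|/s_lt|//] := ltngtP i j; rewrite eq_s ltnn.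
have [c cP] := choice (fun j : 'I_n.+1 => spanb 'X_[s j]).
pose C := \matrix_(j < n.+1, i < n) c j i.
have : kermx C != 0.
  by rewrite kermx_eq0 /row_free neq_ltn ltnS rank_leq_col.
move=> /rowV0Pn[v /sub_kermxP vC /rV0Pn[j0 v_j0]].
apply: (nHs j0).
have Hv : H (\sum_(j < n.+1) v 0 j *: 'X_[s j]).
  (* As [v] is in the left kernel of [C], the subtracted combinations of the [b i] cancel. *)
  have -> : \sum_(j < n.+1) v 0 j *: 'X_[s j] =
      \sum_(j < n.+1) v 0 j *: ('X_[s j] - \sum_(i < n) c j i *: b i).
    under [RHS]eq_bigr do rewrite scalerBr scaler_sumr.
    rewrite sumrB exchange_big /= [X in _ - X]big1 ?subr0 // => i _.
    under eq_bigr do rewrite scalerA.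
    rewrite -scaler_suml; have := congr1 (fun A : 'rV_n => A 0 i) vC.
    rewrite !mxE => sum0; rewrite [X in X *: _](_ : _ = 0) ?scale0r // -[RHS]sum0.
    by apply: eq_bigr => j _; rewrite mxE.
  apply: ideal_sum => // j _; rewrite -mul_mpolyC.
  by case: iH => _ _; apply.
(* Since [v 0 j0] is nonzero, [s j0] is in the support of an element of the monomial ideal [H]. *)
move: Hv; rewrite [in X in X -> _](monomial_idealE monH); apply.
rewrite mcoeff_msupp raddf_sum /= (bigD1 j0) //= big1 => [|j ne_j].
  by rewrite mcoeffZ mcoeffX eqxx mulr1 addr0.
by rewrite mcoeffZ mcoeffX (inj_eq inj_s) val_eqE (negPf ne_j) mulr0.
Qed.

(** If no docle element lay above [a], one could climb outside [H] beyond the degree bound. *)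
Lemma zero_dimensional_docle H a : monomial_ideal H -> zero_dimensional H ->
  ~ H 'X_[a] <-> exists2 b, (a <= b)%MM & docle H 'X_[b].
Proof.
move=> monH zdH; have iH := monomial_ideal_ideal monH.
split=> [nHa|[b le_ab /docleX - /(_ iH)[nHb _] Ha]]; last first.
  exact/nHb/(ideal_up iH Ha).
have [N boundN] := zero_dimensional_bounded monH zdH.
apply: contrapT => nob.
have [|c [nHc _]] := climb_mdeg (D := [set b | ~ H 'X_[b]]) nHa _ N; last first.
  by rewrite leqNgt boundN.
move=> b /= nHb le_ab; apply: contrapT => noi; apply: nob; exists b => //.
apply/docleX => //; split=> // i; apply: contrapT => nHbi; apply: noi.
by exists i.
Qed.

(* With no maximal monomials outside J, every monomial outside J lies below one
   outside J of arbitrarily large degree, hence in H. *)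
Lemma docle_free_component I J H a :
    monomial_ideal J -> monomial_ideal H -> I = J `&` H ->
    zero_dimensional H -> docle J = set0 ->
  J 'X_[a] <-> forall c, (a <= c)%MM -> H 'X_[c] -> I 'X_[c].
Proof.
move=> monJ monH -> zdH docJ; have iJ := monomial_ideal_ideal monJ.
split=> [Ja c le_ac Hc|aP]; first by split=> //; apply: (ideal_up iJ Ja).
have [N boundN] := zero_dimensional_bounded monH zdH.
apply: contrapT => nJa.
have [|c [/= nJc le_ac le_N]] := climb_mdeg (D := [set b | ~ J 'X_[b]]) nJa _ N.
  move=> b /= nJb _; apply: contrapT => noi.
  suff : docle J 'X_[b] by rewrite docJ.
  apply/docleX => //; split=> // i; apply: contrapT => nJbi; apply: noi.
  by exists i.
(* Beyond the bound [c] lies in [H], so [aP] puts it in the intersection and thus in [J]. *)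
apply: nJc; apply: (aP c le_ac _).1; apply: contrapT => /boundN.
by rewrite ltnNge le_N.
Qed.

End MonomialIdealSupport.

(** * Existence and uniqueness of the decomposition *)

Theorem corollary5p10 (K : fieldType) (d : nat) (I : set {mpoly K[d]})
    (hI : monomial_ideal I) (hdoc : docle I <> set0) :
  exists! JH : set {mpoly K[d]} * set {mpoly K[d]},
    [/\ monomial_ideal JH.1 /\ monomial_ideal JH.2,
        I = JH.1 `&` JH.2,
        zero_dimensional JH.2,
        docle JH.2 = docle I
      & docle JH.1 = set0].
Proof.
have iI := monomial_ideal_ideal hI; have upI := ideal_up iI.
(* [UH] is the complement of the down-closure of the docle of [I]; [UJ] is the largest up-closed set
   meeting [UH] only in exponents of [I]. *)
pose UH : set 'X_{1..d} := [set b | forall a, docle I 'X_[a] -> ~ (b <= a)%MM].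
pose UJ : set 'X_{1..d} := [set b | forall c, (b <= c)%MM -> UH c -> I 'X_[c]].
have upH : up_closed UH.
  by move=> a b Ha le_ab c /Ha nle_ac /(lepm_trans le_ab).
have upJ : up_closed UJ.
  by move=> a b Ja le_ab c le_bc; apply: Ja; apply: lepm_trans le_bc.
have sIH a : I 'X_[a] -> UH a.
  by move=> Ia b /docleX - /(_ iI)[nIb _] /(upI _ _ Ia).
pose H : set {mpoly K[d]} := supported_in UH.
pose J : set {mpoly K[d]} := supported_in UJ.
have monH : monomial_ideal H by apply: supported_in_monomial.
have monJ : monomial_ideal J by apply: supported_in_monomial.
have iH := monomial_ideal_ideal monH; have iJ := monomial_ideal_ideal monJ.
have HX a : H 'X_[a] <-> UH a by apply: supported_inX.
have JX a : J 'X_[a] <-> UJ a by apply: supported_inX.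
have docI_nH a : docle I 'X_[a] -> ~ UH a.
  by move=> aP /(_ a aP); apply; apply: lepm_refl.
have eqI : I = J `&` H.
  rewrite [LHS](monomial_idealE hI); apply/seteqP; split=> [f If|f [Jf Hf] m mf].
    split=> m /If /= Im; last exact: sIH.
    by move=> c le_mc _; apply: upI le_mc.
  by apply: (Jf m mf); [apply: lepm_refl|apply: Hf].
have zdH : zero_dimensional H.
  apply: bounded_zero_dimensional => //.
  (* An exponent outside [H] lies below one in the docle of [I], an antichain and so of bounded
     degree. *)
  have [N boundN] := antichain_mdeg_bounded (D := [set a | docle I 'X_[a]])
    (fun a b => docle_antichain iI).
  exists N => a nHa; apply: contrapT => /negP; rewrite -leqNgt => le_N.
  apply: nHa; apply/HX => b /boundN lt_bN /mdeg_le /(leq_trans le_N).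
  by rewrite leqNgt lt_bN.
have docH : docle H = docle I.
  apply: docle_eq => a; split=> [/docleX - /(_ iH)[nHa Ha]|aP].
    have [b bP le_ab] : exists2 b, docle I 'X_[b] & (a <= b)%MM.
      by apply: contrapT => nob; apply/nHa/HX => b bP le_ab; apply: nob; exists b.
    (* If [a] is strictly below [b], some [a + U_(i)] is still below [b], hence outside [H]. *)
    have [->//|/eqP ne_ab] := eqVneq a b.
    have [i le_aib] := lem_lt_addU le_ab ne_ab.
    by have /HX/(_ b bP) := Ha i.
  apply/docleX => //; split=> [/HX|i]; first exact: docI_nH.
  by apply/HX/sIH; have /docleX - /(_ iI)[] := aP.
have docJ : docle J = set0.
  apply/seteqP; split=> // f fP; have [[b _ def_f] _] := fP.
  move: fP; rewrite -def_f => /docleX - /(_ iJ)[nJb Jb].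
  (* For [c] other than [b], some [b + U_(i)] lies below [c]. For [c = b], all [b + U_(i)] lie in
     [J] and [H], so in [I]; were [b] outside [I], it would be in the docle of [I], which misses
     [UH]. *)
  apply/nJb/JX => c le_bc Hc.
  have [eq_bc|/eqP ne_bc] := eqVneq b c; last first.
    by have [i le_bic] := lem_lt_addU le_bc ne_bc; have /JX := Jb i; apply.
  rewrite -eq_bc in Hc *; apply: contrapT => nIb.
  apply: (docI_nH b _ Hc); apply/docleX => //; split=> // i.
  have /JX := Jb i; apply; first exact: lepm_refl.
  by apply: upH Hc _; apply: lem_addr.
exists (J, H); split=> // -[J' H'] /= [[monJ' monH'] eqI' zdH' docH' docJ'].
have eqH : H = H'.
  apply: monomial_ideal_eq => // a; apply/iff_not2.
  rewrite (zero_dimensional_docle a monH zdH) docH -docH'.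
  by rewrite -(zero_dimensional_docle a monH' zdH').
congr (_, _) => //.
(* The monomials of [J] and of [J'] are described by [I] and the common [H] alone. *)
apply: monomial_ideal_eq => // a.
rewrite (docle_free_component a monJ monH eqI zdH docJ).
rewrite (docle_free_component a monJ' monH' eqI' zdH' docJ').
by rewrite eqH.
Qed.
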